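(* Let $G$ be a graph on $n$ nodes with adjacency matrix $A$, $G\neq K_n$ and $G\neq\overline{K_n}$. Let $\mu_{\min}$ and $\mu_{\max}$ be the minimum and maximum eigenvalues of $V^TAV$, let $m(\mu_{\max})$ be the multiplicity of $\mu_{\max}$, and let $Z_l=VU_l$. If $G$ is a cluster graph, i.e., if $\mu_{\min}=-1$, then \[ \dim_S(G)=\begin{cases} n-1-m(\mu_{\max}) & \text{if } AZ_l=\mu_{\max}Z_l,\\ n-1 & \text{otherwise.}\end{cases} \]
   Context: Graphs are simple. $e$ is the all-ones vector in $\mathbb{R}^n$. $V$ is an $n\times(n-1)$ matrix whose columns form an orthonormal basis of $e^\perp$, i.e. $V^Te=0$ and $V^TV=I_{n-1}$. $U_l$ is an $(n-1)\times m(\mu_{\max})$ matrix whose columns form an orthonormal basis of the eigenspace of $V^TAV$ associated with $\mu_{\max}$. A Euclidean representation of $G$ in $\mathbb{R}^r$ is a configuration of points $p^1,\ldots,p^n\in\mathbb{R}^r$ for which there are two distinct positive scalars $\alpha\neq\beta$ such that for all $i\neq j$, $\|p^i-p^j\|^2=\alpha$ if $\{i,j\}$ is an edge of $G$, and $\|p^i-p^j\|^2=\beta$ otherwise. It is a spherical representation in $\mathbb{R}^r$ if the points lie on an $(r-1)$-sphere in $\mathbb{R}^r$ (of any radius and center). $\dim_S(G)$ is the smallest $r$ for which $G$ admits a spherical representation in $\mathbb{R}^r$. A cluster graph is a disjoint union of complete graphs (an isolated node $K_1$ counts as complete). For a non-null graph $G$, being a cluster graph is equivalent to $\mu_{\min}=-1$.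 $\overline{K_n}$ is the null graph (no edges). *)

(* Defs.v *)
From HB Require Import structures.
From mathcomp Require Import all_boot all_order all_algebra.
From mathcomp Require Import reals.

Set Implicit Arguments.
Unset Strict Implicit.
Unset Printing Implicit Defensive.

Import Order.TTheory GRing.Theory Num.Theory.
Local Open Scope ring_scope.

Record simple_graph (n : nat) := SimpleGraph {
  adj :> rel 'I_n;
  adj_sym : symmetric adj;
  adj_irr : irreflexive adj
}.

Definition complete_graph n (G : simple_graph n) : Prop :=
  forall i j, G i j = (i != j).

Definition null_graph n (G : simple_graph n) : Prop :=
  forall i j, G i j = false.

(* The blocks of P are the vertex sets of the complete graphs whose disjoint
   union is G; singleton blocks are the isolated vertices. *)
Definition cluster_graph n (G : simple_graph n) : Prop :=
  exists2 P : {set {set 'I_n}},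
    partition P [set: 'I_n] &
    forall i j, G i j = (i != j) && (j \in pblock P i).

Section Real.
Variable R : realType.

Definition adjmx n (G : simple_graph n) : 'M[R]_n :=
  \matrix_(i, j) (G i j)%:R.

Definition min_eigenvalue k (M : 'M[R]_k) (mu : R) : Prop :=
  eigenvalue M mu /\ forall a, eigenvalue M a -> mu <= a.

Definition max_eigenvalue k (M : 'M[R]_k) (mu : R) : Prop :=
  eigenvalue M mu /\ forall a, eigenvalue M a -> a <= mu.

Definition multiplicity k (M : 'M[R]_k) (mu : R) : nat :=
  \rank (eigenspace M mu).

(* V^T e = 0 and V^T V = I_{n-1}: by a dimension count, the columns of V form
   an orthonormal basis of the orthogonal complement of e. *)
Definition orthonormal_basis_eperp n (V : 'M[R]_(n, n.-1)) : Prop :=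
  V^T *m (const_mx 1 : 'cV[R]_n) = 0 /\ V^T *m V = 1%:M.

(* [eigenspace] consists of row eigenvectors, so the columns of U are
   transposed, and M is transposed to make them right eigenvectors of M. *)
Definition orthonormal_eigenbasis k m (M : 'M[R]_k) (mu : R)
    (U : 'M[R]_(k, m)) : Prop :=
  U^T *m U = 1%:M /\ (U^T == eigenspace M^T mu)%MS.

(* Squared Euclidean distance; the norm that MathComp-Analysis puts on row
   vectors is the sup norm. *)
Definition sqdist r (x y : 'rV[R]_r) : R :=
  \sum_k (x 0 k - y 0 k) ^+ 2.

Definition euclidean_representation n (G : simple_graph n) r
    (p : 'I_n -> 'rV[R]_r) : Prop :=
  exists alpha beta : R,
    [/\ 0 < alpha, 0 < beta, alpha != beta &
        forall i j, i != j ->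
          sqdist (p i) (p j) = if G i j then alpha else beta].

Definition on_sphere n r (p : 'I_n -> 'rV[R]_r) : Prop :=
  exists (c : 'rV[R]_r) (rho : R),
    0 < rho /\ forall i, sqdist (p i) c = rho ^+ 2.

Definition has_spherical_representation n (G : simple_graph n) (r : nat) : Prop :=
  exists p : 'I_n -> 'rV[R]_r,
    euclidean_representation G p /\ on_sphere p.

Definition is_dimS n (G : simple_graph n) (d : nat) : Prop :=
  has_spherical_representation G d /\
  forall r, has_spherical_representation G r -> (d <= r)%N.

End Real.

(* Main.v *)
Require Import Defs.
From HB Require Import structures.
From mathcomp Require Import all_boot all_order all_algebra.
From mathcomp Require Import reals complex ring lra zify.

(** Write M for V^T A V, the adjacency matrix compressed to the hyperplane
    e^perp, and let k = n - 1.

    Distances and M.  The squared distances of a representation with parameters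
    alpha and beta form the matrix D = beta (J - I) + (alpha - beta) A.  On
    e^perp a squared-distance matrix is -2 times a Gram matrix, so the rows p^i
    of a configuration P satisfy
      beta I - (alpha - beta) M = 2 (V^T P) (V^T P)^T   ([two_distance_gram]).
    Conversely, whenever the left-hand side is positive semidefinite of rank at
    most r, factoring it as 2 X X^T with r columns ([psd_factor]) and taking the
    rows of V X realizes alpha and beta in dimension r ([gram_realization]).
    Thus low-dimensional representations are the ways of making the left-hand
    side singular and positive semidefinite.

    Spheres.  If a zero-sum vector z kills the configuration, i.e. P^T z = 0,
    then seeing the distances from the centre of a sphere gives D z = 0
    ([spherical_kernel]).  Conversely, the linear system for a centre is
    solvable as soon as D annihilates V ker(beta I - (alpha - beta) M)
    ([spherical_realization]).

    The spectrum.  For a cluster graph, I + A is a sum of all-ones blocks, hence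
    positive semidefinite, and it kills the difference of two adjacent vertices,
    so mu_min = -1.  A graph that is not a cluster graph has an induced path on
    three vertices, whose zero-sum vector (1, -2, 1) has a negative value under
    I + A, so mu_min is not -1.  For a cluster graph other than K_n, the zero-sum
    vector (1, 1, -2) on an edge and a vertex outside its cluster gives
    mu_max > 0.  The extremal eigenvalues control the quadratic form of M by the
    Rayleigh principle ([rayleigh_max]).

    The dimension.  If r < k the left-hand side is singular, so
    beta / (alpha - beta) is an eigenvalue of M.  If alpha < beta this eigenvalue
    is smaller than -1, which mu_min = -1 forbids; so alpha > beta, and positive
    semidefiniteness forces beta / (alpha - beta) = mu_max.  The rank is then
    k - m(mu_max), and sphericity says exactly that A Z = mu_max Z
    ([low_dim_spherical]).  Both values are attained: alpha = mu_max + 1 and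
    beta = mu_max, positive because mu_max > 0, give dimension k - m(mu_max) when
    A Z = mu_max Z, while alpha = 1 and beta = 2 make 2 I + M nonsingular, so that
    a spherical representation exists in dimension k. *)

Set Implicit Arguments.
Unset Strict Implicit.
Unset Printing Implicit Defensive.

Import Order.TTheory GRing.Theory Num.Theory.
Local Open Scope ring_scope.

(** * Positive semidefinite matrices *)

Definition psd (R : numDomainType) k (M : 'M[R]_k) : Prop :=
  forall x : 'rV_k, 0 <= (x *m M *m x^T) 0 0.

(** The Rayleigh principle, obtained from the spectral theorem over the complex
    numbers: a real symmetric matrix is unitarily diagonalizable there, its
    diagonal entries are real and hence real eigenvalues of M, so in the
    eigenbasis the form of c I - M is a sum of squared moduli with nonnegative
    weights. *)
Lemma rayleigh_max (R : rcfType) k (M : 'M[R]_k) (c : R) :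
  M^T = M -> (forall a, eigenvalue M a -> a <= c) -> psd (c%:M - M).
Proof.
move=> Msym Mle x.
pose f := real_complex R; pose MC := map_mx f M.
have fconj z : (f z)^* = f z.
  by apply/CrealP; apply/complex_realP; exists z.
have MCsym : MC \is hermsymmx.
  apply: realsym_hermsym; last first.
    by apply/mxOverP => i j; rewrite mxE; apply/complex_realP; exists (M i j).
  by apply/is_hermitianmxP; rewrite expr0 scale1r map_mx_id // /MC map_trmx Msym.
have /orthomx_spectralP MCE := hermitian_normalmx MCsym.
have /mxOverP dreal := hermitian_spectral_diag_real MCsym.
have PV := invmx_unitary (spectral_unitarymx MC).
set P := spectralmx MC in MCE PV *.
set d := spectral_diag MC in MCE dreal *.
have Pu : P \in unitmx := spectral_unit MC.
(* The rows of P are eigenvectors, and eigenvalues descend to R. *)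
have dle j : d 0 j <= f c.
  have /complex_realP[a da] := dreal 0 j.
  rewrite da lecR; apply: Mle.
  have : eigenvalue MC (d 0 j); last by rewrite da eigenvalue_map.
  apply/eigenvalueP; exists (row j P); last first.
    apply: contraTneq isT => P0; have := row_mul j P (invmx P).
    rewrite P0 mul0mx mulmxV // => /rowP /(_ j) /eqP.
    by rewrite !mxE eqxx oner_eq0.
  rewrite -row_mul MCE !mulmxA mulmxV // mul1mx.
  by rewrite row_mul row_diag_mx -scalemxAl -rowE.
rewrite -lecR -[X in _ <= X]/(f _).
pose y := map_mx f x *m invmx P.
have -> : f ((x *m (c%:M - M) *m x^T) 0 0) = \sum_j (f c - d 0 j) * (y 0 j * (y 0 j)^*).
  have fmx (B : 'M[R]_1) : f (B 0 0) = map_mx f B 0 0 by rewrite mxE.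
  rewrite fmx.
  rewrite !map_mxM map_mxB map_scalar_mx /= -/MC.
  have -> : (f c)%:M - MC = invmx P *m diag_mx (const_mx (f c) - d) *m P.
    rewrite linearB /= mulmxBr mulmxBl -MCE; congr (_ - _).
    by rewrite diag_const_mx mul_mx_scalar -scalemxAl mulVmx // scalemx1.
  have yE : P *m map_mx f x^T = map_mx (@Num.conj _) y^T.
    rewrite trmx_mul map_mxM PV; congr (_ *m _); apply/matrixP => i j.
      by rewrite !mxE; exact/esym/conjCK.
    by rewrite !mxE; exact/esym/fconj.
  rewrite !mulmxA -/y -mulmxA yE !mxE; apply: eq_bigr => j _.
  by rewrite mul_mx_diag !mxE /=; ring.
apply: sumr_ge0 => j _; apply: mulr_ge0; first by rewrite subr_ge0.
by rewrite mul_conjC_ge0.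
Qed.

(** Entry rules for a single operation: they leave the entries of matrix
    products folded, which [mxE] would expand into sums. *)
Lemma addmxE (R : nmodType) m n (A B : 'M[R]_(m, n)) i j :
  (A + B) i j = A i j + B i j.
Proof. by rewrite mxE. Qed.

Lemma oppmxE (R : zmodType) m n (A : 'M[R]_(m, n)) i j : (- A) i j = - A i j.
Proof. by rewrite mxE. Qed.

Lemma scalemxE (R : pzRingType) m n (a : R) (A : 'M[R]_(m, n)) i j :
  (a *: A) i j = a * A i j.
Proof. by rewrite mxE. Qed.

Lemma delta_form (R : pzSemiRingType) k (B : 'M[R]_k) i j :
  ((delta_mx 0 i : 'rV_k) *m B *m (delta_mx 0 j : 'rV_k)^T) 0 0 = B i j.
Proof. by rewrite -rowE trmx_delta -colE !mxE. Qed.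

(** The values of the form at the sum and at the difference of two basis vectors
    are opposite once the diagonal vanishes. *)
Lemma psd_diag0 (R : realFieldType) k (B : 'M[R]_k) :
  B^T = B -> psd B -> (forall i, B i i = 0) -> B = 0.
Proof.
move=> Bsym Bpsd B0; apply/matrixP => i j; rewrite mxE.
have Bji : B j i = B i j by rewrite -[in LHS]Bsym mxE.
have := Bpsd (delta_mx 0 i + delta_mx 0 j).
have := Bpsd (delta_mx 0 i - delta_mx 0 j).
rewrite !raddfB !raddfD /= !(mulmxDl, mulmxDr, mulNmx, mulmxN).
rewrite !(addmxE, oppmxE) !delta_form !B0 Bji.
lra.
Qed.

(** Cholesky's step, counted by rank rather than by size: if B i i is nonzero,
    subtracting col i B * row i B / B i i keeps the matrix semidefinite (this is
    Cauchy-Schwarz) and adds the i-th basis vector to its kernel, so one rank-one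
    Gram matrix lowers the rank by one.  This gives a factor with as many columns
    as the rank. *)
Lemma psd_factor (R : rcfType) k (B : 'M[R]_k) r :
  B^T = B -> psd B -> (\rank B <= r)%N -> exists X : 'M_(k, r), X *m X^T = B.
Proof.
elim: r B => [|r IHr] B Bsym Bpsd.
  rewrite leqn0 mxrank_eq0 => /eqP ->.
  by exists 0; rewrite mul0mx.
case: (pickP (fun i => B i i != 0)) => [i Bii0 rB|B0 _]; last first.
  exists 0; rewrite mul0mx (psd_diag0 Bsym Bpsd) // => i.
  exact/eqP/negbNE/negbT/B0.
have Bii : 0 < B i i by rewrite lt_def Bii0 -delta_form Bpsd.
have colT : (col i B)^T = row i B by rewrite tr_col Bsym.
have rowT : (row i B)^T = col i B by rewrite tr_row Bsym.
pose B1 := B - (B i i)^-1 *: (col i B *m row i B).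
have [||| X1 X1E] := IHr B1.
- by rewrite /B1 linearB linearZ /= trmx_mul colT rowT Bsym.
- move=> y; pose t := (y *m col i B) 0 0.
  have yc : y *m col i B = t%:M by rewrite [LHS]mx11_scalar.
  have ry : row i B *m y^T = t%:M by rewrite -colT -trmx_mul yc tr_scalar_mx.
  pose e : 'rV[R]_k := delta_mx 0 i; pose s := t / B i i.
  have eB : e *m B = row i B by rewrite -rowE.
  have Be : B *m e^T = col i B by rewrite trmx_delta -colE.
  have re : row i B *m e^T = (B i i)%:M.
    by rewrite -eB [LHS]mx11_scalar delta_form.
  (* This vector is the component of y that is B-orthogonal to e. *)
  have := Bpsd (y - s *: e).
  rewrite (_ : (y - s *: e)^T = y^T - s *: e^T); last by rewrite raddfB /= linearZ.
  rewrite /B1 !(mulmxDl, mulmxDr, mulNmx, mulmxN) -!scalemxAr -!scalemxAl eB.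
  rewrite -(mulmxA y B e^T) Be mulmxA -(mulmxA _ (row i B)) yc ry re.
  rewrite !(addmxE, oppmxE, scalemxE) -scalar_mxM !mxE !eqxx !mulr1n.
  by congr (_ <= _); rewrite /s; field.
- rewrite -ltnS; apply: leq_trans rB.
  have lt_ker : (kermx B < kermx B1)%MS.
    apply/andP; split.
      apply/sub_kermxP; rewrite /B1 mulmxBr mulmx_ker -scalemxAr colE !mulmxA.
      by rewrite mulmx_ker !mul0mx scaler0 subr0.
    apply: contra (Bii0) => kerle.
    have : ((delta_mx 0 i : 'rV_k) <= kermx B)%MS.
      apply: submx_trans kerle; apply/sub_kermxP.
      rewrite /B1 mulmxBr -scalemxAr mulmxA -!rowE.
      rewrite [row i (col i B)]mx11_scalar !mxE mul_scalar_mx scalerA mulVf ?scale1r ?subrr //.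
    by move/sub_kermxP; rewrite -rowE => /rowP/(_ i); rewrite !mxE => /eqP.
  have := rank_ltmx lt_ker; rewrite !mxrank_ker.
  have := rank_leq_row B; have := rank_leq_row B1; lia.
rewrite -[r.+1]add1n; exists (row_mx ((Num.sqrt (B i i))^-1 *: col i B) X1).
rewrite tr_row_mx mul_row_col X1E linearZ /= colT -scalemxAl -scalemxAr scalerA.
by rewrite -expr2 exprVn sqr_sqrtr ?ltW // addrC subrK.
Qed.

(** * Compression to the zero-sum hyperplane *)

Section Compression.

Variables (R : realType) (n : nat) (V : 'M[R]_(n, n.-1)).
Hypothesis hV : orthonormal_basis_eperp V.

Local Notation e := (const_mx 1 : 'cV[R]_n).

Lemma eperp_tr m (W : 'M[R]_(n.-1, m)) : e^T *m (V *m W) = 0.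
Proof.
have -> : e^T *m (V *m W) = (V^T *m e)^T *m W by rewrite trmx_mul trmxK mulmxA.
by rewrite hV.1 trmx0 mul0mx.
Qed.

(** The columns of V span the whole of e^perp, because V has rank n - 1; so
    V V^T is the orthogonal projection onto it. *)
Lemma eperp_proj m (x : 'M[R]_(m, n)) : x *m e = 0 -> x *m V *m V^T = x.
Proof.
move=> xe; case: (posnP n) => [n0|n_gt0].
  by apply/matrixP => i j; exfalso; move: (ltn_ord j); rewrite {2}n0.
have rV : \rank V^T = n.-1.
  apply/eqP; rewrite eqn_leq rank_leq_row /=.
  by rewrite -{1}(mxrank1 R n.-1) -hV.2 mxrankM_maxl.
have re : \rank e = 1%N.
  apply/eqP; rewrite eqn_leq rank_leq_col lt0n mxrank_eq0.
  apply/eqP => /matrixP /(_ (Ordinal n_gt0) 0) /eqP.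
  by rewrite !mxE oner_eq0.
have Vker : (V^T == kermx e)%MS.
  rewrite -mxrank_leqif_eq; last exact/sub_kermxP/hV.1.
  by rewrite mxrank_ker rV re subn1.
have : (x <= V^T)%MS by rewrite (eqmxP Vker); apply/sub_kermxP.
by case/submxP => y ->; rewrite -(mulmxA y) hV.2 mulmx1.
Qed.

Lemma compress_scalar (c : R) (N : 'M[R]_n) :
  V^T *m (c%:M - N) *m V = c%:M - V^T *m N *m V.
Proof.
by rewrite mulmxBr mulmxBl mul_mx_scalar -scalemxAl hV.2 scalemx1.
Qed.

(** Semidefiniteness of a compressed matrix is tested on explicit zero-sum
    vectors of R^n, without mentioning V. *)
Lemma compress_psd_eperp (N : 'M[R]_n) (d : 'rV_n) :
  psd (V^T *m N *m V) -> d *m e = 0 -> 0 <= (d *m N *m d^T) 0 0.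
Proof.
move=> psdN de; have := psdN (d *m V).
have VVd : V *m (V^T *m d^T) = d^T.
  by rewrite -{2}(eperp_proj de) !trmx_mul trmxK.
by rewrite trmx_mul !mulmxA (eperp_proj de) -!mulmxA VVd.
Qed.

End Compression.

Lemma psd_compress (R : numDomainType) n k (V : 'M[R]_(n, k)) (N : 'M[R]_n) :
  psd N -> psd (V^T *m N *m V).
Proof.
move=> psdN x; have := psdN (x *m V^T).
by rewrite trmx_mul trmxK !mulmxA.
Qed.

Lemma dot_self_ge0 (R : realDomainType) k (x : 'rV[R]_k) :
  0 <= (x *m x^T) 0 0.
Proof. by rewrite mxE; apply: sumr_ge0 => j _; rewrite mxE -expr2 sqr_ge0. Qed.

Lemma dot_self_gt0 (R : realDomainType) k (x : 'rV[R]_k) :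
  x != 0 -> 0 < (x *m x^T) 0 0.
Proof.
case/rV0Pn => i xi; rewrite mxE (bigD1 i) //= mxE -expr2.
rewrite ltr_pwDl ?exprn_even_gt0 //.
by apply: sumr_ge0 => j _; rewrite mxE -expr2 sqr_ge0.
Qed.

Lemma psd_eigenvalue_le (R : realFieldType) k (M : 'M[R]_k) (c a : R) :
  psd (c%:M - M) -> eigenvalue M a -> a <= c.
Proof.
move=> psdM /eigenvalueP[x xM x0]; have := psdM x.
rewrite mulmxBr xM mul_mx_scalar -scalerBl -scalemxAl scalemxE.
by rewrite pmulr_lge0 ?dot_self_gt0 // subr_ge0.
Qed.

Lemma eigenvalueN (R : fieldType) k (M : 'M[R]_k) (a : R) :
  eigenvalue (- M) a -> eigenvalue M (- a).
Proof.
case/eigenvalueP => x xM x0; apply/eigenvalueP; exists x => //.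
by rewrite scaleNr -xM mulmxN opprK.
Qed.

(** * Cluster graphs *)

Section Graphs.

Variables (n : nat) (G : simple_graph n).

Lemma non_complete_pair : ~ complete_graph G ->
  exists i j, i != j /\ ~~ G i j.
Proof.
move=> hK; case: (pickP (fun q : 'I_n * 'I_n => (q.1 != q.2) && ~~ G q.1 q.2)).
  by case=> i j /= /andP[]; exists i, j.
move=> noq; case: hK => i j; have /= := noq (i, j).
have [->|ij] := eqVneq i j; first by rewrite adj_irr.
by move/negbT; rewrite negbK.
Qed.

Lemma non_null_edge : ~ null_graph G -> exists i j, G i j.
Proof.
move=> hN; case: (pickP (fun q : 'I_n * 'I_n => G q.1 q.2)).
  by case=> i j /= Gij; exists i, j.
by move=> noq; case: hN => i j; have := noq (i, j).
Qed.

Lemma edge_neq i j : G i j -> i != j.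
Proof. by apply: contraTneq => ->; rewrite adj_irr. Qed.

(** A cluster graph is one without an induced path on three vertices: equality
    or adjacency is then an equivalence relation, whose classes are the
    clusters. *)
Lemma cluster_transP : cluster_graph G <->
  (forall u v w, G u v -> G v w -> u != w -> G u w).
Proof.
split=> [[P partP GP] u v w|Gtr].
  have triv : trivIset P by case/and3P: partP.
  have covP : cover P = [set: 'I_n] by case/and3P: partP => /eqP.
  have same i j : j \in pblock P i -> pblock P i = pblock P j.
    by move=> ji; apply/esym/same_pblock.
  rewrite !GP => /andP[_ /same ->] /andP[_ wv] ->.
  by [].
pose r := [rel i j | (i == j) || G i j].
have eqr : {in [set: 'I_n] & &, equivalence_rel r}.
  move=> x y z _ _ _; split=> [|]; first by rewrite /= eqxx.
  rewrite /=; have [->//|xy] /= := eqVneq x y => Gxy.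
  have Gyx : G y x by rewrite adj_sym.
  have [<-|xz] /= := eqVneq x z; first by rewrite Gyx orbT.
  have [<-//|yz] /= := eqVneq y z.
  by apply/idP/idP => [Gxz|Gyz]; [apply: Gtr Gyx Gxz yz|apply: Gtr Gxy Gyz xz].
exists (equivalence_partition r [set: 'I_n]); first exact: equivalence_partitionP.
move=> i j; rewrite (pblock_equivalence_partition eqr) ?inE //=.
by have [->|] := eqVneq i j; rewrite ?adj_irr.
Qed.

(** I + A is S S^T, where S is the vertex-cluster incidence matrix. *)
Lemma cluster_psd (R : realType) : cluster_graph G -> psd (1%:M + adjmx R G).
Proof.
case=> P partP GP.
have triv : trivIset P by case/and3P: partP.
have covP i : i \in cover P by case/and3P: partP => /eqP->.
pose S : 'M[R]_(n, #|P|) := \matrix_(i < n, b < #|P|) (i \in (enum_val b : {set _}))%:R.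
have -> : 1%:M + adjmx R G = S *m S^T.
  apply/matrixP => i j; rewrite !mxE.
  under eq_bigr do rewrite !mxE.
  rewrite -(big_enum_val (fun b : {set _} => (i \in b)%:R * (j \in b)%:R)) /=.
  rewrite (bigD1 (pblock P i)) ?pblock_mem //= mem_pblock covP mul1r big1.
    rewrite addr0 GP; have [->|] := eqVneq i j; rewrite ?mem_pblock ?covP ?addr0 ?add0r //.
  move=> b /andP[bP bi]; case: (boolP (i \in b)) => [ib|_]; last by rewrite mul0r.
  by rewrite (def_pblock triv bP ib) eqxx in bi.
by move=> x; rewrite mulmxA -mulmxA -trmx_mul dot_self_ge0.
Qed.

End Graphs.

(** * The spectrum of a cluster graph *)

Section ClusterSpectrum.

Variables (R : realType) (n : nat) (G : simple_graph n).
Variable V : 'M[R]_(n, n.-1).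
Hypothesis hV : orthonormal_basis_eperp V.

Local Notation e := (const_mx 1 : 'cV[R]_n).
Local Notation A := (adjmx R G).
Local Notation M := (V^T *m A *m V).
Lemma adjmx_tr : A^T = A.
Proof. by apply/matrixP => i j; rewrite !mxE adj_sym. Qed.

Lemma compress_adjmx_tr : M^T = M.
Proof. by rewrite !trmx_mul trmxK adjmx_tr mulmxA. Qed.

Lemma delta_ones i : ('e_i : 'rV_n) *m e = const_mx 1.
Proof. by rewrite -rowE row_const. Qed.

Lemma max_eigenvalue_psd mu : max_eigenvalue M mu -> psd (mu%:M - M).
Proof. by case=> _; apply: rayleigh_max; exact: compress_adjmx_tr. Qed.

(** The zero-sum test vector on three vertices.  With centre v of an induced path
    u - v - w it detects graphs that are not cluster graphs; with v outside the
    cluster of an edge u w it makes the form of A positive. *)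
Definition cherry (u w v : 'I_n) : 'rV[R]_n := 'e_u + 'e_w - 2 *: 'e_v.

Lemma cherry_ones u w v : cherry u w v *m e = 0.
Proof.
rewrite mulmxBl mulmxDl -scalemxAl !delta_ones.
by apply/matrixP => i j; rewrite !mxE; lra.
Qed.

Lemma cherry_form (N : 'M[R]_n) u w v : N^T = N ->
  (cherry u w v *m N *m (cherry u w v)^T) 0 0
  = N u u + N w w + 4 * N v v + 2 * N u w - 4 * N u v - 4 * N w v.
Proof.
move=> Nsym; have Nc i j : N j i = N i j by rewrite -[in LHS]Nsym mxE.
have -> : (cherry u w v)^T = ('e_u)^T + ('e_w)^T - 2 *: ('e_v)^T.
  by rewrite raddfB raddfD /= linearZ.
rewrite !(mulmxDl, mulmxDr, mulNmx, mulmxN) -?scalemxAl -?scalemxAr.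
rewrite !(addmxE, oppmxE, scalemxE) !delta_form (Nc u w) (Nc u v) (Nc w v).
by ring.
Qed.

(** Adjacent vertices of a cluster graph are twins, so their difference is an
    eigenvector for -1; no eigenvalue is smaller since I + A is semidefinite. *)
Lemma cluster_min_eigenvalue mu :
  cluster_graph G -> ~ null_graph G -> min_eigenvalue M mu -> mu = -1.
Proof.
move=> clG /non_null_edge[u [v Guv]] [eigmu minmu].
have trG := iffLR (cluster_transP G) clG.
apply/le_anti/andP; split.
  pose d : 'rV[R]_n := 'e_u - 'e_v.
  have de : d *m e = 0 by rewrite mulmxBl !delta_ones subrr.
  have dA : d *m A = - d.
    apply/rowP => j; rewrite mulmxBl -!rowE !mxE.
    have uv := edge_neq Guv; have Gvu : G v u by rewrite adj_sym.
    have [->|ju] := eqVneq j u.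
      by rewrite adj_irr Gvu (negPf uv) /=; lra.
    have [->|jv] := eqVneq j v.
      by rewrite adj_irr Guv /=; lra.
    have -> : G u j = G v j.
      by apply/idP/idP => [Guj|Gvj]; [apply: trG Gvu Guj _|apply: trG Guv Gvj _]; rewrite eq_sym.
    by rewrite /=; lra.
  apply: minmu; apply/eigenvalueP; exists (d *m V).
    by rewrite !mulmxA (eperp_proj hV de) dA mulNmx scaleN1r.
  apply: contraTneq (edge_neq Guv) => dV0.
  have := eperp_proj hV de; rewrite dV0 mul0mx => /rowP /(_ u) /eqP.
  rewrite !mxE !eqxx /=; case: (u == v) => //=.
  by move/eqP; lra.
have psdM : psd (1%:M - - M).
  rewrite opprK -[1%:M + M](_ : V^T *m (1%:M + A) *m V = _).
    exact/psd_compress/cluster_psd.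
  by rewrite mulmxDr mulmxDl mulmx1 hV.2.
have : eigenvalue (- M) (- mu).
  case/eigenvalueP: eigmu => x xM x0; apply/eigenvalueP; exists x => //.
  by rewrite mulmxN xM scaleNr.
by move/(psd_eigenvalue_le psdM); rewrite lerNl.
Qed.

(** On an induced path u - v - w the form of I + A takes the value 6 - 8 < 0 at
    [cherry u w v]. *)
Lemma min_eigenvalue_cluster : min_eigenvalue M (-1) -> cluster_graph G.
Proof.
move=> [_ minM]; apply/cluster_transP => u v w Guv Gvw uw.
have psdM : psd (1%:M - - M).
  apply: rayleigh_max; first by rewrite linearN /= compress_adjmx_tr.
  by move=> a /eigenvalueN /minM; rewrite lerN2.
have {}psdM : psd (V^T *m (1%:M + A) *m V).
  by move: psdM; rewrite opprK mulmxDr mulmxDl mulmx1 hV.2.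
have CT : (1%:M + A)^T = 1%:M + A by rewrite linearD /= trmx1 adjmx_tr.
have := compress_psd_eperp hV psdM (cherry_ones u w v).
rewrite (cherry_form _ _ _ CT) !mxE !eqxx (negPf uw) (negPf (edge_neq Guv)).
rewrite (eq_sym w v) (negPf (edge_neq Gvw)) !adj_irr Guv (adj_sym G w v) Gvw.
by case: (G u w) => //=; lra.
Qed.

(** As the graph is not complete, some vertex w lies outside the cluster of a
    given edge u v; the form of A at [cherry u v w] is then 2. *)
Lemma cluster_max_eigenvalue_gt0 mu : cluster_graph G ->
  ~ complete_graph G -> ~ null_graph G -> max_eigenvalue M mu -> 0 < mu.
Proof.
move=> clG /non_complete_pair[i [j [ij nGij]]] /non_null_edge[u [v Guv]] hmu.
have trG := iffLR (cluster_transP G) clG.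
have Gvu : G v u by rewrite adj_sym.
have [w nGuw nGvw] : exists2 w, ~~ G u w & ~~ G v w.
  (* The vertices near u are those of its cluster. *)
  have near x : G u x || G v x -> (x == u) || G u x.
    have [->//|xu /=] := eqVneq x u; case/orP => // Gvx.
    by apply: trG Guv Gvx _; rewrite eq_sym.
  have block x y : (x == u) || G u x -> (y == u) || G u y -> x != y -> G x y.
    case/orP => [/eqP ->|Gux] /orP[/eqP ->|Guy] // xy; first by rewrite eqxx in xy.
      by rewrite adj_sym.
    by apply: trG Guy xy; rewrite adj_sym.
  case: (boolP (G u i || G v i)) => [/near ni|]; last by rewrite negb_or => /andP[]; exists i.
  case: (boolP (G u j || G v j)) => [/near nj|]; last by rewrite negb_or => /andP[]; exists j.
  by rewrite (block _ _ ni nj ij) in nGij.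
have psdV : psd (V^T *m (mu%:M - A) *m V).
  by rewrite (compress_scalar hV); apply: max_eigenvalue_psd.
have := compress_psd_eperp hV psdV (cherry_ones u v w).
have := dot_self_ge0 (cherry u v w).
rewrite mulmxBr (mulmxBl (_ *m _)) mul_mx_scalar -scalemxAl addmxE oppmxE scalemxE.
rewrite (cherry_form _ _ _ adjmx_tr); set q := (_ *m _) 0 0 => q0.
rewrite !mxE !adj_irr Guv (negPf nGuw) (negPf nGvw).
by case: (ltrP 0 mu) => // mu0; have := mulr_le0_ge0 mu0 q0; rewrite /=; lra.
Qed.

End ClusterSpectrum.

(** * Distance matrices of two-distance configurations *)

Section DistanceMatrices.

Variables (R : realType) (n : nat) (G : simple_graph n).

Local Notation e := (const_mx 1 : 'cV[R]_n).
Local Notation A := (adjmx R G).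

Definition distmx r (p : 'I_n -> 'rV[R]_r) : 'M[R]_n :=
  \matrix_(i, j) sqdist (p i) (p j).

(** The squared-distance matrix that the parameters alpha and beta prescribe. *)
Definition two_distmx (alpha beta : R) : 'M[R]_n :=
  beta *: (const_mx 1 - 1%:M) + (alpha - beta) *: A.

Lemma sqdist_dot r (x y : 'rV[R]_r) : sqdist x y = ((x - y) *m (x - y)^T) 0 0.
Proof. by rewrite mxE; apply: eq_bigr => k _; rewrite !mxE expr2. Qed.

(** The polarization identity, with an arbitrary origin c: the origin 0 serves
    general configurations, the centre of a sphere makes a constant. *)
Lemma distmx_gram r (p : 'I_n -> 'rV[R]_r) (c : 'rV[R]_r) :
  let a := \col_i sqdist (p i) c in
  let Q := \matrix_i (p i - c) in
  distmx p = a *m e^T + e *m a^T - 2 *: (Q *m Q^T).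
Proof.
apply/matrixP => i j; rewrite !mxE !big_ord1 !mxE mul1r mulr1 /sqdist.
rewrite mulr_sumr -big_split -sumrB /=; apply: eq_bigr => k _.
by rewrite !mxE; ring.
Qed.

Lemma two_distmx_diag alpha beta i : two_distmx alpha beta i i = 0.
Proof. by rewrite !mxE adj_irr eqxx /=; ring. Qed.

Lemma two_distmx_off alpha beta i j : i != j ->
  two_distmx alpha beta i j = if G i j then alpha else beta.
Proof. by move=> ij; rewrite !mxE (negPf ij); case: (G i j) => /=; ring. Qed.

Lemma sqdistxx r (x : 'rV[R]_r) : sqdist x x = 0.
Proof. by apply: big1 => k _; rewrite subrr expr0n. Qed.

Lemma two_distmxP r (p : 'I_n -> 'rV[R]_r) alpha beta :
  (forall i j, i != j -> sqdist (p i) (p j) = if G i j then alpha else beta)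
  <-> distmx p = two_distmx alpha beta.
Proof.
split=> [pG|/matrixP pG i j ij].
  apply/matrixP => i j; rewrite [LHS]mxE.
  have [->|ij] := eqVneq i j; first by rewrite two_distmx_diag sqdistxx.
  by rewrite two_distmx_off // pG.
by rewrite -two_distmx_off // -pG mxE.
Qed.

Lemma mul_two_distmx alpha beta m (W : 'M[R]_(n, m)) : e^T *m W = 0 ->
  two_distmx alpha beta *m W = (alpha - beta) *: (A *m W) - beta *: W.
Proof.
move=> eW; rewrite mulmxDl -!scalemxAl mulmxBl mul1mx.
have -> : (const_mx 1 : 'M[R]_n) = e *m e^T.
  by apply/matrixP => i j; rewrite !mxE big_ord1 !mxE mulr1.
by rewrite -mulmxA eW mulmx0 sub0r scalerN addrC.
Qed.

Variable V : 'M[R]_(n, n.-1).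
Hypothesis hV : orthonormal_basis_eperp V.
Local Notation M := (V^T *m A *m V).

Lemma compress_two_distmx alpha beta :
  V^T *m two_distmx alpha beta *m V = (alpha - beta) *: M - beta%:M.
Proof.
have eV : e^T *m V = 0 by rewrite -[V]mulmx1 (eperp_tr hV).
by rewrite -mulmxA mul_two_distmx // mulmxBr -!scalemxAr hV.2 scalemx1 mulmxA.
Qed.

(** The two rank-one terms of the polarization identity vanish between V^T and V,
    which leaves a Gram matrix with r columns. *)
Lemma two_distance_gram r (p : 'I_n -> 'rV[R]_r) alpha beta :
  (forall i j, i != j -> sqdist (p i) (p j) = if G i j then alpha else beta) ->
  let Y := V^T *m \matrix_i p i in
  beta%:M - (alpha - beta) *: M = 2 *: (Y *m Y^T).
Proof.
move=> /two_distmxP pG Y; rewrite -[LHS]opprB -compress_two_distmx -pG.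
rewrite (distmx_gram p 0) /= (_ : \matrix_i (p i - 0) = \matrix_i p i); last first.
  by apply/matrixP => i j; rewrite !mxE subr0.
rewrite /Y trmx_mul trmxK.
rewrite mulmxBr mulmxBl mulmxDr mulmxDl !mulmxA hV.1 !mul0mx addr0.
have eV : e^T *m V = 0 by rewrite -[V]mulmx1 (eperp_tr hV).
rewrite -(mulmxA _ e^T V) eV mulmx0 sub0r opprK.
by rewrite -scalemxAr -scalemxAl !mulmxA.
Qed.

(** Seen from the centre of the sphere, all rank-one terms of the distance matrix
    are multiples of e e^T and disappear on zero-sum vectors; moving the origin
    does not change P^T z for zero-sum z. *)
Lemma spherical_kernel r (p : 'I_n -> 'rV[R]_r) m (W : 'M[R]_(n.-1, m)) :
  on_sphere p -> (V^T *m \matrix_i p i)^T *m W = 0 ->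
  distmx p *m (V *m W) = 0.
Proof.
case=> c [rho [_ pc]] YW.
have eVW := eperp_tr hV W.
have -> : distmx p *m (V *m W) =
    - 2 *: (\matrix_i (p i - c) *m ((\matrix_i (p i - c))^T *m (V *m W))).
  rewrite (distmx_gram p c) /= (_ : \col_i sqdist (p i) c = rho ^+ 2 *: e).
    rewrite linearZ /= mulmxBl mulmxDl -scalemxAr -!scalemxAl.
    rewrite -!(mulmxA e e^T) eVW mulmx0 !scaler0 addr0 sub0r.
    by rewrite mulmxA scaleNr.
  by apply/matrixP => i j; rewrite !mxE pc mulr1.
have -> : (\matrix_i (p i - c) : 'M_(n, r)) = \matrix_i p i - e *m c.
  by apply/matrixP => i j; rewrite !mxE big_ord1 !mxE mul1r.
rewrite [(_ - _)^T]raddfB /= trmx_mul [(_ - _) *m (V *m W)]mulmxBl.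
rewrite -(mulmxA c^T) eVW mulmx0 subr0.
by move: YW; rewrite trmx_mul trmxK [_ *m (V *m W)]mulmxA => ->; rewrite mulmx0 scaler0.
Qed.

End DistanceMatrices.

(** * Spherical representations *)

Lemma difference_form (R : pzRingType) k (N : 'M[R]_k) i j :
  let d : 'rV_k := 'e_i - 'e_j in
  (d *m N *m d^T) 0 0 = N i i - N j i - (N i j - N j j).
Proof.
rewrite /= raddfB /= !(mulmxBl, mulmxBr) /= !(addmxE, oppmxE) !delta_form.
by rewrite !opprB.
Qed.

Lemma gram_eq0 (R : realDomainType) m n (Z : 'M[R]_(m, n)) :
  Z^T *m Z = 0 -> Z = 0.
Proof.
move=> ZZ; apply/matrixP => i j; rewrite [RHS]mxE; apply/eqP.
have /eqP : (Z^T *m Z) j j = 0 by rewrite ZZ mxE.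
rewrite mxE psumr_eq0 => [/allP /(_ i)|k _]; rewrite !mxE -expr2 ?sqr_ge0 //.
by rewrite mem_index_enum sqrf_eq0; apply.
Qed.

Section Spherical.

Variables (R : realType) (n : nat) (G : simple_graph n).
Variable V : 'M[R]_(n, n.-1).
Hypothesis hV : orthonormal_basis_eperp V.

Local Notation e := (const_mx 1 : 'cV[R]_n).
Local Notation A := (adjmx R G).
Local Notation M := (V^T *m A *m V).

(** Distances only involve differences of basis vectors, which are zero-sum; so
    they are determined by the compressed matrix. *)
Lemma gram_realization (alpha beta : R) r (X : 'M[R]_(n.-1, r)) :
  beta%:M - (alpha - beta) *: M = 2 *: (X *m X^T) ->
  distmx (fun i => row i (V *m X)) = two_distmx G alpha beta.
Proof.
move=> XE; set D := two_distmx G alpha beta.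
have XX : X *m X^T = - 2^-1 *: (V^T *m D *m V).
  rewrite compress_two_distmx // -[_ - _]opprB XE scalerN scaleNr opprK scalerA.
  by rewrite mulVf ?scale1r ?pnatr_eq0.
apply/matrixP => i j; rewrite mxE sqdist_dot.
pose d : 'rV[R]_n := 'e_i - 'e_j.
have de : d *m e = 0 by rewrite mulmxBl !delta_ones subrr.
have dVV : d *m V *m V^T = d by apply: eperp_proj.
have VVd : V *m (V^T *m d^T) = d^T by rewrite -{2}dVV !trmx_mul trmxK.
have -> : row i (V *m X) - row j (V *m X) = d *m V *m X.
  by rewrite !rowE -mulmxBl mulmxA.
have -> : d *m V *m X *m (d *m V *m X)^T = - 2^-1 *: (d *m D *m d^T).
  rewrite !trmx_mul !mulmxA -(mulmxA _ X) XX -scalemxAr -!scalemxAl.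
  by rewrite !mulmxA dVV -!mulmxA VVd.
rewrite scalemxE difference_form !two_distmx_diag.
have -> : D j i = D i j by rewrite !mxE adj_sym eq_sym.
by field.
Qed.

(** The points are the rows of V X, with beta I - (alpha - beta) M = 2 X X^T.  With
    a the vector of their squared norms, a centre c / 2 must satisfy
    c X^T = a^T V, which is solvable exactly when a^T V vanishes on ker X^T.  For
    W in that kernel the distance matrix D satisfies D V W = e (a^T V W), and the
    left-hand side is 0 by assumption. *)
Lemma spherical_realization (alpha beta : R) r (i0 j0 : 'I_n) : i0 != j0 ->
  0 < alpha -> 0 < beta -> alpha != beta ->
  psd (beta%:M - (alpha - beta) *: M) ->
  (\rank (beta%:M - (alpha - beta) *: M)%R <= r)%N ->
  (forall m (W : 'M[R]_(n.-1, m)), (beta%:M - (alpha - beta) *: M) *m W = 0 ->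
     two_distmx G alpha beta *m (V *m W) = 0) ->
  has_spherical_representation R G r.
Proof.
move=> ij0 a0 b0 ab; set N := _ - _ => psdN rN kerN.
have NT : (2^-1 *: N)^T = 2^-1 *: N.
  by rewrite linearZ linearB /= linearZ /= tr_scalar_mx compress_adjmx_tr.
have psdN2 : psd (2^-1 *: N).
  move=> x; rewrite -scalemxAr -scalemxAl scalemxE.
  by rewrite mulr_ge0 // invr_ge0 ler0n.
have [X XX] : exists X : 'M_(n.-1, r), X *m X^T = 2^-1 *: N.
  by apply: psd_factor; rewrite // mxrank_scale_nz // invr_eq0 pnatr_eq0.
have NX : N = 2 *: (X *m X^T).
  by rewrite XX scalerA mulfV ?scale1r // pnatr_eq0.
pose p i := row i (V *m X).
have pD : distmx p = two_distmx G alpha beta by apply: gram_realization.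
have pG := iffRL (two_distmxP G p alpha beta) pD.
have PE : \matrix_i p i = V *m X by apply/row_matrixP => i; rewrite rowK.
exists p; split; first by exists alpha, beta.
pose a := \col_i sqdist (p i) 0.
have [c cX] : exists c, a^T *m V = c *m X^T.
  apply/submxP; rewrite submxE; set W := cokermx _.
  have XW : X^T *m W = 0 by apply: mulmx_coker.
  have := kerN _ W; rewrite NX -scalemxAl -mulmxA XW mulmx0 scaler0 => /(_ erefl).
  rewrite -pD (distmx_gram p 0) /= (_ : \matrix_i (p i - 0) = V *m X); last first.
    by rewrite -PE; apply/matrixP => i j; rewrite !mxE subr0.
  rewrite mulmxBl mulmxDl -(mulmxA _ e^T) (eperp_tr hV) mulmx0 add0r -scalemxAl.
  rewrite trmx_mul -!mulmxA (mulmxA V^T) hV.2 mul1mx XW !mulmx0 scaler0 subr0.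
  move/(congr1 (row i0)); rewrite row_mul row_const row0.
  have -> : const_mx 1 = 1%:M :> 'M[R]_1.
    by apply/matrixP => i j; rewrite !mxE !ord1 eqxx.
  by rewrite mul1mx mulmxA => ->.
have sphE i : sqdist (p i) (2^-1 *: c) =
    a i 0 - (a^T *m V *m V^T) 0 i + 4^-1 * sqdist c 0.
  have -> : (a^T *m V *m V^T) 0 i = (c *m (p i)^T) 0 0.
    rewrite cX -mulmxA -trmx_mul -PE.
    by rewrite !mxE; apply: eq_bigr => k _; rewrite !mxE.
  rewrite [a _ _]mxE [(c *m _) _ _]mxE /sqdist mulr_sumr -sumrB -big_split /=.
  by apply: eq_bigr => k _; rewrite !mxE; field.
have const i j : sqdist (p i) (2^-1 *: c) = sqdist (p j) (2^-1 *: c).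
  rewrite !sphE; congr (_ + _).
  pose d : 'rV[R]_n := 'e_i - 'e_j.
  have de : d *m e = 0 by rewrite mulmxBl !delta_ones subrr.
  have : (d *m V *m V^T *m a) 0 0 = (d *m a) 0 0 by rewrite (eperp_proj hV de).
  have -> : d *m V *m V^T *m a = d *m (a^T *m V *m V^T)^T.
    by rewrite !trmx_mul !trmxK !mulmxA.
  rewrite !mulmxBl -!rowE !(addmxE, oppmxE) ![row _ _ _ _]mxE ![_^T _ 0]mxE.
  lra.
set s := sqdist (p i0) (2^-1 *: c).
(* Radius 0 would make all points coincide. *)
have s0 : 0 < s.
  rewrite lt_def; apply/andP; split; last by apply: sumr_ge0 => k _; exact: sqr_ge0.
  apply/eqP => s0.
  have pc i : p i = 2^-1 *: c.
    apply/eqP; rewrite -subr_eq0; apply: contraTT isT => /dot_self_gt0.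
    by rewrite -sqdist_dot (const i i0) -/s s0 ltxx.
  have := pG i0 j0 ij0; rewrite !pc sqdistxx.
  by case: (G i0 j0) => h; [move: a0|move: b0]; rewrite -h ltxx.
exists (2^-1 *: c), (Num.sqrt s); split; first by rewrite sqrtr_gt0.
by move=> i; rewrite sqr_sqrtr ?ltW // (const i i0).
Qed.

(** Fewer than n - 1 dimensions make the Gram matrix singular, which pins down
    the ratio of alpha and beta: beta / (alpha - beta) = mu_max. *)
Lemma low_dim_spherical mu_min mu_max r :
  min_eigenvalue M mu_min -> max_eigenvalue M mu_max -> -1 <= mu_min ->
  (r < n.-1)%N -> has_spherical_representation R G r ->
  (n.-1 - multiplicity M mu_max <= r)%N /\
  forall m (W : 'M[R]_(n.-1, m)),
    M *m W = mu_max *: W -> A *m (V *m W) = mu_max *: (V *m W).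
Proof.
move=> [_ minM] hmax mu1 rn [p [[alpha [beta [a0 b0 ab pG]]] sph]].
have := two_distance_gram hV pG; set Y := V^T *m _ => /= YE.
pose g := alpha - beta.
have g0 : g != 0 by rewrite subr_eq0.
(* Y has fewer columns than rows, hence a left kernel. *)
have eig : eigenvalue M (beta / g).
  have /rowV0Pn[x xk x0] : kermx Y != 0.
    rewrite -mxrank_eq0 mxrank_ker -lt0n subn_gt0.
    by apply: leq_ltn_trans rn; rewrite rank_leq_col.
  apply/eigenvalueP; exists x => //.
  have xY : x *m Y = 0 by apply/sub_kermxP.
  have : x *m (beta%:M - g *: M) = 0 by rewrite YE -scalemxAr mulmxA xY mul0mx scaler0.
  rewrite mulmxBr mul_mx_scalar -scalemxAr => /eqP; rewrite subr_eq0 => /eqP h.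
  by apply: (scalerI g0); rewrite -h scalerA mulrCA divff ?mulr1.
(* Otherwise beta / g < -1, as g > - beta. *)
have gpos : 0 < g.
  rewrite lt_def g0 /=; rewrite leNgt; apply/negP => gneg.
  have := le_trans mu1 (minM _ eig); rewrite ler_ndivlMr //.
  by rewrite /g; lra.
have muE : mu_max = beta / g.
  apply/le_anti/andP; split; last exact: hmax.2.
  apply: (psd_eigenvalue_le _ hmax.1) => x.
  have -> : (beta / g)%:M - M = g^-1 *: (beta%:M - g *: M).
    rewrite scalerBr scalerA mulVf // scale1r; congr (_ - _).
    by rewrite -scalemx1 -[in RHS]scalemx1 scalerA mulrC.
  rewrite YE -!scalemxAr -!scalemxAl !scalemxE (mulmxA x Y) -(mulmxA (x *m Y)) -trmx_mul.
  by rewrite mulr_ge0 ?invr_ge0 ?(ltW gpos) // mulr_ge0 ?ler0n ?dot_self_ge0.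
have NE : beta%:M - g *: M = g *: (mu_max%:M - M).
  by rewrite muE scalerBr scale_scalar_mx mulrCA divff // mulr1.
split.
  rewrite /multiplicity /eigenspace mxrank_ker subKn ?rank_leq_row //.
  have -> : \rank (M - mu_max%:M) = \rank (2 *: (Y *m Y^T)).
    by rewrite -YE NE mxrank_scale_nz // -[in RHS]opprB mxrank_opp.
  rewrite mxrank_scale_nz ?pnatr_eq0 //.
  by apply: leq_trans (mxrankM_maxl _ _) _; rewrite rank_leq_col.
move=> m W MW.
have YW : Y^T *m W = 0.
  have : W^T *m (2 *: (Y *m Y^T)) *m W = 0.
    by rewrite -YE NE -mulmxA -scalemxAl mulmxBl MW mul_scalar_mx subrr scaler0 mulmx0.
  rewrite -scalemxAr -scalemxAl => /eqP; rewrite scaler_eq0 pnatr_eq0 /= => /eqP h.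
  by apply: gram_eq0; rewrite trmx_mul trmxK mulmxA -(mulmxA _ Y).
have := spherical_kernel hV sph YW.
have /two_distmxP -> := pG.
rewrite (mul_two_distmx _ _ _ (eperp_tr hV W)) => /eqP; rewrite subr_eq0 => /eqP h.
by apply: (scalerI g0); rewrite h muE scalerA mulrCA divff ?mulr1.
Qed.

End Spherical.

(** * The spherical dimension of a cluster graph *)

Lemma eigenbasisP (R : fieldType) k m (M : 'M[R]_k) mu (U : 'M[R]_(k, m)) :
  M^T = M -> (U^T == eigenspace M^T mu)%MS ->
  M *m U = mu *: U /\
  forall q (W : 'M[R]_(k, q)), M *m W = mu *: W -> exists Y, W = U *m Y.
Proof.
move=> MT /eqmxP UE; split=> [|q W MW].
  apply: trmx_inj; rewrite trmx_mul linearZ /= .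
  by apply/eigenspaceP; rewrite -UE.
have : (W^T <= U^T)%MS.
  by rewrite UE; apply/eigenspaceP; rewrite -trmx_mul MW linearZ.
by case/submxP => Y WY; exists Y^T; rewrite -[W]trmxK WY trmx_mul trmxK.
Qed.

Theorem corollary5p1 (R : realType) (n : nat) (G : simple_graph n)
  (hK : ~ complete_graph G) (hN : ~ null_graph G)
  (V : 'M[R]_(n, n.-1)) (hV : orthonormal_basis_eperp V)
  (mu_min mu_max : R)
  (hmin : min_eigenvalue (V^T *m adjmx R G *m V) mu_min)
  (hmax : max_eigenvalue (V^T *m adjmx R G *m V) mu_max)
  (U : 'M[R]_(n.-1, multiplicity (V^T *m adjmx R G *m V) mu_max))
  (hU : orthonormal_eigenbasis (V^T *m adjmx R G *m V) mu_max U) :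
  (cluster_graph G <-> mu_min = -1) /\
  (cluster_graph G ->
   is_dimS R G
     (if adjmx R G *m (V *m U) == mu_max *: (V *m U)
      then n.-1 - multiplicity (V^T *m adjmx R G *m V) mu_max
      else n.-1)%N).
Proof.
have MT := compress_adjmx_tr G V.
set M := V^T *m adjmx R G *m V in hmin hmax U hU MT *.
split; first split=> [clG|mu1].
- exact: (cluster_min_eigenvalue hV clG hN hmin).
- by apply: (min_eigenvalue_cluster hV); rewrite -mu1.
move=> clG.
have mu1 : -1 <= mu_min by rewrite (cluster_min_eigenvalue hV clG hN hmin).
have mu0 := cluster_max_eigenvalue_gt0 hV clG hK hN hmax.
have [MU UY] := eigenbasisP MT hU.2.
have [i0 [j0 /edge_neq ij0]] := non_null_edge hN.
have low r := low_dim_spherical hV hmin hmax mu1 (r := r).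
case: ifP => [/eqP AVU|AVU]; split=> [|r sph].
- have gap1 : mu_max + 1 - mu_max = 1 by ring.
  apply: (spherical_realization hV (alpha := mu_max + 1) (beta := mu_max) ij0) => //.
  + by rewrite addr_gt0.
  + by rewrite -subr_eq0 gap1 oner_eq0.
  + by rewrite gap1 scale1r; apply: max_eigenvalue_psd.
  + rewrite gap1 scale1r /multiplicity /eigenspace mxrank_ker subKn ?rank_leq_row //.
    by rewrite -opprB mxrank_opp.
  + move=> m W; rewrite gap1 scale1r mulmxBl mul_scalar_mx => /eqP.
    rewrite subr_eq0 => /eqP /esym /UY[Y ->].
    rewrite mul_two_distmx ?(eperp_tr hV) // gap1 scale1r.
    by rewrite (mulmxA V) mulmxA AVU -scalemxAl subrr.
- by case: (leqP n.-1 r) => [|/low /(_ sph) []//]; apply: leq_trans; rewrite leq_subr.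
- have NE : 2%:M - (1 - 2) *: M = 2%:M - - M :> 'M[R]_n.-1.
    by rewrite (_ : 1 - 2 = -1) ?scaleN1r //; ring.
  have NT : (- M)^T = - M by rewrite linearN /= MT.
  have leN a : eigenvalue (- M) a -> a <= 1.
    by move/eigenvalueN/hmin.2/(le_trans mu1); rewrite lerN2.
  apply: (spherical_realization hV (alpha := 1) (beta := 2) ij0) => //.
  + by rewrite -subr_eq0; apply/eqP; lra.
  + rewrite NE; apply: rayleigh_max NT _ => a.
    by move/leN; lra.
  + exact: rank_leq_row.
  + move=> m W; rewrite NE => NW.
    suff -> : W = 0 by rewrite !mulmx0.
    apply/eqP; rewrite -trmx_eq0; apply: contraTT isT => W0.
    have : eigenvalue (- M) 2.
      apply: contra W0 => /eqP E0; rewrite -submx0 -E0; apply/eigenspaceP.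
      move: NW; rewrite mulmxBl mul_scalar_mx => /eqP; rewrite subr_eq0 => /eqP h.
      by rewrite -linearZ h /= trmx_mul NT.
    by move/leN; lra.
- rewrite leqNgt; apply/negP => /low /(_ sph) [_ /(_ _ U MU)].
  by move/eqP; rewrite AVU.
Qed.
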